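(* For $n\ge 2$ let $u=u_n$ be the state on $\mathbb{C}S_n$ determined by $u(\delta^\sigma)=\langle \xi, P(\sigma)\xi\rangle$ for $\sigma\in S_n$, where $P$ is the permutation representation of $S_n$ on $\mathbb{C}^n$, $P(\sigma)e_i=e_{\sigma(i)}$, and $\xi\in\mathbb{C}^n$ is the unit vector with components $$\alpha_i=\sqrt{n^{n-i}\,\frac{n-1}{n^n-1}},\qquad i=1,\dots,n.$$ Let $\pi$ be the Haar state of $\widehat{S_n}$. Then for every $\alpha>1$ and every $A<1$ there exists $N$ such that for all $n\ge N$ and all real $c\ge 0$ for which $k=\alpha\, n^{n-1}\ln(n)/2+c\,n^{n-2}$ is a positive integer, $$\|u^{\star k}-\pi\|^2\leq\frac12 e^{-2Ac}.$$
   Context: $\mathbb{C}S_n$ is the group algebra of the symmetric group $S_n$ with basis $\{\delta^\sigma:\sigma\in S_n\}$, product $\delta^\sigma\delta^{\sigma'}=\delta^{\sigma\sigma'}$, involution $(\delta^\sigma)^*=\delta^{\sigma^{-1}}$ and its $\mathrm{C}^*$-algebra structure; with comultiplication $\Delta(\delta^\sigma)=\delta^\sigma\otimes\delta^\sigma$ it is the algebra of functions $F(\widehat{S_n})$ on the finite quantum group $\widehat{S_n}$. Its Haar state is $\pi(\delta^\sigma)=1$ if $\sigma=e$ and $0$ otherwise. A state is a positive linear functional of norm one. The convolution powers of a state $u$ are $u^{\star 1}=u$, $u^{\star(k+1)}=(u\otimes u^{\star k})\Delta$. The total variation distance between states $\nu,\mu$ on $\mathbb{C}S_n$ is $\|\nu-\mu\|=\sup_p|\nu(p)-\mu(p)|$,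 the supremum over projections $p\in\mathbb{C}S_n$ ($p=p^*=p^2$). *)

(* Defs.v *)
From HB Require Import structures.
From mathcomp Require Import all_boot all_order all_algebra all_fingroup.
From mathcomp Require Import complex.
From mathcomp Require Import all_classical all_reals all_analysis.

Set Implicit Arguments.
Unset Strict Implicit.
Unset Printing Implicit Defensive.

Import Order.TTheory GRing.Theory Num.Theory.
Import ComplexField.

Local Open Scope ring_scope.
Local Open Scope complex_scope.
Local Open Scope classical_set_scope.

(* An element of the group algebra is the family of its coefficients in the
   basis (delta s).  The alias keeps its ring structure (convolution) apart
   from the pointwise one that {ffun _ -> _} carries. *)
Definition galg (R : realType) (n : nat) : Type := {ffun 'S_n -> R[i]^o}.

Section GroupAlgebra.
Context {R : realType} {n : nat}.
Local Notation C := R[i].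
Local Notation A := (galg R n).

HB.instance Definition _ := Choice.on A.
HB.instance Definition _ := GRing.Lmodule.copy A {ffun 'S_n -> R[i]^o}.

Implicit Types (a b c : A) (s t : 'S_n).

Definition gcoef a s : C := (a : {ffun 'S_n -> R[i]^o}) s.

Definition galg_of (F : 'S_n -> C) : A := [ffun s => F s].

Definition delta s : A := galg_of (fun t => (t == s)%:R).

(* MathComp multiplies permutations from left to right:
   (s * t)%g maps i to t (s i).  The group law used here is composition
   of maps, so that (t * s)%g stands for the product s t (cf. delta_mul);
   accordingly (s * t^-1)%g below stands for t^-1 s. *)
Definition galg_mul a b : A :=
  galg_of (fun s => \sum_t gcoef a t * gcoef b (s * t^-1)%g).

Definition galg_star a : A := galg_of (fun s => (gcoef a (s^-1)%g)^*).

Lemma galgP a b : (forall s, gcoef a s = gcoef b s) -> a = b.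
Proof. by move=> ab; apply/ffunP => s; exact: ab. Qed.

Lemma gcoefE F s : gcoef (galg_of F) s = F s.
Proof. by rewrite /gcoef /galg_of ffunE. Qed.

Lemma gcoefD a b s : gcoef (a + b) s = gcoef a s + gcoef b s.
Proof. exact: ffunE. Qed.

Lemma gcoefZ (k : C) a s : gcoef (k *: a) s = k * gcoef a s.
Proof. exact: ffunE. Qed.

Lemma gcoef_delta s t : gcoef (delta s) t = (t == s)%:R.
Proof. exact: gcoefE. Qed.

Fact galg_mulA : associative galg_mul.
Proof.
move=> a b c; apply: galgP => s; rewrite !gcoefE.
under eq_bigr => t _ do rewrite gcoefE mulr_sumr.
under [RHS]eq_bigr => t _ do rewrite gcoefE mulr_suml.
rewrite [RHS]exchange_big /=; apply: eq_bigr => t _.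
rewrite [RHS](reindex_inj (mulIg t)) /=; apply: eq_bigr => r _.
by rewrite mulgK invMg !mulgA mulrA.
Qed.

Fact galg_mul1l : left_id (delta 1%g) galg_mul.
Proof.
move=> a; apply: galgP => s; rewrite gcoefE (bigD1 1%g) //= big1 ?addr0.
  by rewrite gcoef_delta eqxx mul1r invg1 mulg1.
by move=> t /negPf t1; rewrite gcoef_delta t1 mul0r.
Qed.

Fact galg_mul1r : right_id (delta 1%g) galg_mul.
Proof.
move=> a; apply: galgP => s; rewrite gcoefE (bigD1 s) //= big1 ?addr0.
  by rewrite mulgV gcoef_delta eqxx mulr1.
by move=> t /negPf ts; rewrite gcoef_delta -eq_mulgV1 eq_sym ts mulr0.
Qed.

Fact galg_mulDl : left_distributive galg_mul +%R.
Proof.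
move=> a b c; apply: galgP => s; rewrite gcoefD !gcoefE -big_split /=.
by apply: eq_bigr => t _; rewrite gcoefD mulrDl.
Qed.

Fact galg_mulDr : right_distributive galg_mul +%R.
Proof.
move=> a b c; apply: galgP => s; rewrite gcoefD !gcoefE -big_split /=.
by apply: eq_bigr => t _; rewrite gcoefD mulrDr.
Qed.

Fact galg_1_neq0 : delta 1%g != 0.
Proof.
apply/eqP => /(congr1 (fun a => gcoef a 1%g)).
by rewrite gcoef_delta eqxx /gcoef ffunE => /eqP; rewrite oner_eq0.
Qed.

HB.instance Definition _ := GRing.Zmodule_isNzRing.Build A
  galg_mulA galg_mul1l galg_mul1r galg_mulDl galg_mulDr galg_1_neq0.

Fact galg_scaleAl (k : C) a b : k *: (a * b) = (k *: a) * b.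
Proof.
apply: galgP => s; rewrite gcoefZ !gcoefE mulr_sumr.
by apply: eq_bigr => t _; rewrite gcoefZ mulrA.
Qed.

HB.instance Definition _ := GRing.Lmodule_isLalgebra.Build C A galg_scaleAl.

Fact galg_scaleAr (k : C) a b : k *: (a * b) = a * (k *: b).
Proof.
apply: galgP => s; rewrite gcoefZ !gcoefE mulr_sumr.
by apply: eq_bigr => t _; rewrite gcoefZ mulrCA.
Qed.

HB.instance Definition _ := GRing.Lalgebra_isAlgebra.Build C A galg_scaleAr.

Lemma gcoefM a b s :
  gcoef (a * b) s = \sum_t gcoef a t * gcoef b (s * t^-1)%g.
Proof. exact: gcoefE. Qed.

Lemma delta_mul s t : delta s * delta t = delta (t * s)%g.
Proof.
apply: galgP => r; rewrite gcoefE (bigD1 s) //= big1 ?addr0.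
  rewrite !gcoef_delta eqxx mul1r; congr (_%:R); congr nat_of_bool.
  by apply/eqP/eqP => [<-|->]; rewrite ?mulgKV ?mulgK.
by move=> x /negPf xs; rewrite gcoef_delta xs mul0r.
Qed.

Lemma delta_star s : galg_star (delta s) = delta (s^-1)%g.
Proof.
apply: galgP => t; rewrite gcoefE !gcoef_delta (can2_eq invgK invgK).
by rewrite conjc_nat.
Qed.

Lemma gcoef_sum (I : finType) (F : I -> A) s :
  gcoef (\sum_i F i) s = \sum_i gcoef (F i) s.
Proof.
by apply: (big_morph (gcoef^~ s)) => [a b|]; [exact: gcoefD | rewrite /gcoef ffunE].
Qed.

Lemma galg_basis a : a = \sum_s gcoef a s *: delta s.
Proof.
apply: galgP => t; rewrite gcoef_sum (bigD1 t) //= big1 => [|s /negPf ts].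
  by rewrite addr0 gcoefZ gcoef_delta eqxx mulr1.
by rewrite gcoefZ gcoef_delta eq_sym ts mulr0.
Qed.

(* The functional with prescribed values on the basis. *)
Definition lin_ext (F : 'S_n -> C) a : C := \sum_s gcoef a s * F s.

Fact lin_ext_is_scalar F : scalar (lin_ext F).
Proof.
move=> k a b; rewrite /lin_ext mulr_sumr -big_split /=.
by apply: eq_bigr => s _; rewrite gcoefD gcoefZ mulrDl mulrA.
Qed.

HB.instance Definition _ F :=
  GRing.isLinear.Build C A C *%R (lin_ext F) (lin_ext_is_scalar F).

Lemma lin_ext_delta F s : lin_ext F (delta s) = F s.
Proof.
rewrite /lin_ext (bigD1 s) //= big1 => [|t /negPf ts].
  by rewrite gcoef_delta eqxx mul1r addr0.
by rewrite gcoef_delta ts mul0r.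
Qed.

Definition haar : {scalar A} := lin_ext (fun s => (s == 1%g)%:R).

(* The tensor square of A, with basis the delta s (x) delta t. *)
Definition galg2 := {ffun 'S_n * 'S_n -> R[i]^o}.

Definition tens a b : galg2 := [ffun st => gcoef a st.1 * gcoef b st.2].

Definition comul a : galg2 := \sum_s gcoef a s *: tens (delta s) (delta s).

Definition tens_fun (f g : {scalar A}) (x : galg2) : C :=
  \sum_st x st * (f (delta st.1) * g (delta st.2)).

Lemma tens_funE (f g : {scalar A}) a b :
  tens_fun f g (tens a b) = f a * g b.
Proof.
rewrite {2}(galg_basis a) {2}(galg_basis b) !linear_sum big_distrlr /=.
rewrite pair_big /=; apply: eq_bigr => -[s t] _ /=.
by rewrite ffunE !linearZ /= mulrACA.
Qed.

Definition conv_fun (f g : {scalar A}) a : C := tens_fun f g (comul a).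

Lemma conv_funE (f g : {scalar A}) a :
  conv_fun f g a = \sum_s gcoef a s * (f (delta s) * g (delta s)).
Proof.
rewrite /conv_fun /comul /tens_fun.
under eq_bigr => st _ do rewrite sum_ffunE mulr_suml.
rewrite exchange_big /=; apply: eq_bigr => s _.
rewrite -tens_funE /tens_fun mulr_sumr; apply: eq_bigr => st _.
by rewrite ffunE; exact: (esym (mulrA _ _ _)).
Qed.

Fact conv_fun_is_scalar f g : scalar (conv_fun f g).
Proof.
move=> k a b; rewrite !conv_funE mulr_sumr -big_split /=.
by apply: eq_bigr => s _; rewrite gcoefD gcoefZ mulrDl -mulrA.
Qed.

HB.instance Definition _ f g :=
  GRing.isLinear.Build C A C *%R (conv_fun f g) (conv_fun_is_scalar f g).

Definition conv (f g : {scalar A}) : {scalar A} := conv_fun f g.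

(* Only meant for 0 < k. *)
Definition conv_pow (f : {scalar A}) (k : nat) : {scalar A} :=
  iter k.-1 (conv f) f.

Definition l2norm a : R := Num.sqrt (\sum_s Normc.normc (gcoef a s) ^+ 2).

(* The C*-norm: operator norm of the left regular representation. *)
Definition cstar_norm a : \bar R :=
  ereal_sup [set (l2norm (a * b))%:E | b in [set b | l2norm b <= 1]].

Definition functional_norm (f : {scalar A}) : \bar R :=
  ereal_sup [set (Normc.normc (f a))%:E | a in [set a | (cstar_norm a <= 1)%E]].

(* In R[i], 0 <= z means that z is a nonnegative real. *)
Definition is_state (f : {scalar A}) : Prop :=
  (forall a, 0 <= f (galg_star a * a)) /\ functional_norm f = 1%E.

Definition is_projection (p : A) : Prop := p = galg_star p /\ p = p * p.

Definition tv_dist (f g : {scalar A}) : \bar R :=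
  ereal_sup [set (Normc.normc (f p - g p))%:E | p in [set p | is_projection p]].

End GroupAlgebra.

Definition perm_rep (R : realType) (n : nat) (s : 'S_n) : 'M[R[i]]_n :=
  \matrix_(i, j) (i == s j)%:R.

Lemma perm_rep_basis (R : realType) (n : nat) (s : 'S_n) (i : 'I_n) :
  perm_rep R s *m delta_mx i 0 = delta_mx (s i) 0 :> 'cV[R[i]]_n.
Proof.
rewrite -colE; apply/matrixP => j k.
by rewrite !mxE ord1 eqxx andbT.
Qed.

Definition inner (R : realType) (n : nat) (x y : 'cV[R[i]]_n) : R[i] :=
  \sum_i (x i 0)^* * y i 0.

(* The index i : 'I_n runs from 0 to n - 1, whence the shift. *)
Definition xi (R : realType) (n : nat) : 'cV[R[i]]_n :=
  \col_(i < n)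
    (Num.sqrt (n%:R ^+ (n - i.+1) * ((n%:R - 1) / (n%:R ^+ n - 1))))%:C.

Section XiState.
Context (R : realType) (n : nat).
Local Notation C := R[i].
Local Notation A := (galg R n).
Implicit Types (a b : A) (x y : 'cV[C]_n).

Let rep a : 'M[C]_n := \sum_s gcoef a s *: perm_rep R s.

Let cnorm2 x : R := \sum_i Normc.normc (x i 0) ^+ 2.

Let u : {scalar A} := lin_ext (fun s => inner (xi R n) (perm_rep R s *m xi R n)).

Let rep_entry a x i : (rep a *m x) i 0 = \sum_s gcoef a s * x ((s^-1)%g i) 0.
Proof.
rewrite /rep mulmx_suml summxE; apply: eq_bigr => s _.
rewrite -scalemxAl mxE; congr (_ * _).
rewrite mxE (bigD1 ((s^-1)%g i)) //= big1 ?addr0.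
  by rewrite mxE permKV eqxx mul1r.
move=> j /negPf ji; rewrite mxE.
by rewrite -(inj_eq (@perm_inj _ (s^-1)%g)) permK eq_sym ji mul0r.
Qed.

Let uE a : u a = inner (xi R n) (rep a *m xi R n).
Proof.
rewrite /u /= /lin_ext /inner.
under eq_bigr => s _ do rewrite mulr_sumr.
rewrite exchange_big /=; apply: eq_bigr => i _.
rewrite /rep mulmx_suml summxE mulr_sumr; apply: eq_bigr => s _.
by rewrite -scalemxAl [X in _ = _ * X]mxE mulrCA.
Qed.

Let normc_sqr (z : C) : z^* * z = (Normc.normc z ^+ 2)%:C.
Proof. by rewrite rmorphXn mulrC -sqr_normc normc_def; case: z. Qed.

Let rep_mul a b x : rep (a * b) *m x = rep a *m (rep b *m x).
Proof.
apply/colP => i; rewrite !rep_entry.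
under eq_bigr => s _ do rewrite gcoefM mulr_suml.
rewrite exchange_big /=; apply: eq_bigr => t _.
rewrite rep_entry mulr_sumr (reindex_inj (mulIg t)) /=.
apply: eq_bigr => s _; rewrite mulgK mulrA invMg permM //.
Qed.

Let rep_star a x y : inner x (rep (galg_star a) *m y) = inner (rep a *m x) y.
Proof.
rewrite /inner.
under eq_bigr => i _ do rewrite rep_entry mulr_sumr.
under [RHS]eq_bigr => i _ do rewrite rep_entry rmorph_sum mulr_suml.
rewrite exchange_big [RHS]exchange_big (reindex_inj invg_inj) /=.
apply: eq_bigr => s _; rewrite [RHS](reindex_inj (@perm_inj _ s)) /=.
apply: eq_bigr => i _; rewrite gcoefE invgK rmorphM permK.
by rewrite mulrCA mulrA.
Qed.

Let u_pos a : 0 <= u (galg_star a * a).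
Proof.
rewrite uE rep_mul rep_star; apply: sumr_ge0 => i _.
by rewrite normc_sqr lecR sqr_ge0.
Qed.

Let stab (i : 'I_n) : nat := #|[pred s : 'S_n | s i == i]|.

Let normc_inner x y : cnorm2 x <= 1 -> cnorm2 y <= 1 ->
  Normc.normc (inner x y) <= 1.
Proof.
move=> x1 y1.
have nsum (F : 'I_n -> C) : Normc.normc (\sum_i F i) <= \sum_i Normc.normc (F i).
  elim/big_rec2: _ => [|i p q _ pq]; first by rewrite Normc.normc0.
  by rewrite (le_trans (le_normcD _ _)) // lerD2l.
apply: (le_trans (nsum _)).
have -> : 1 = 2^-1 * (1 + 1) :> R by rewrite mulVf ?pnatr_eq0.
apply: (@le_trans _ _ (2^-1 * (cnorm2 x + cnorm2 y))); last first.
  by rewrite ler_wpM2l ?invr_ge0 // lerD.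
rewrite -big_split mulr_sumr; apply: ler_sum => i _ /=.
have -> : Normc.normc ((x i 0)^* * y i 0) = Normc.normc (x i 0) * Normc.normc (y i 0).
  rewrite Normc.normcM; congr (_ * _); case: (x i 0) => p q /=.
  by rewrite sqrrN.
have := sqr_ge0 (Normc.normc (x i 0) - Normc.normc (y i 0)).
rewrite sqrrB => h; rewrite [leRHS]mulrC ler_pdivlMr // -subr_ge0.
by rewrite mulr_natr addrAC.
Qed.

Context (n2 : (2 <= n)%N).

Let xi_unit : cnorm2 (xi R n) = 1.
Proof.
have n1 : (1 : R) < n%:R by rewrite ltr1n.
have nn : (n%:R ^+ n - 1 : R) != 0.
  by rewrite subr_eq0 gt_eqF // exprn_egt1 // -lt0n (ltn_trans _ n2).
have -> : cnorm2 (xi R n) =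
    \sum_(i < n) n%:R ^+ (n - i.+1) * ((n%:R - 1) / (n%:R ^+ n - 1)).
  apply: eq_bigr => i _; rewrite mxE /= expr0n addr0 sqr_sqrtr ?sqr_ge0 //.
  rewrite sqr_sqrtr // mulr_ge0 ?exprn_ge0 // divr_ge0 ?subr_ge0 ?(ltW n1) //.
  by rewrite exprn_ege1 // ltW.
rewrite -mulr_suml (reindex_inj rev_ord_inj) mulrA /=.
under eq_bigr => i _ do rewrite subnSK ?ltn_ord // subKn 1?ltnW //.
by rewrite [_ * (_ - 1)]mulrC -subrX1 divff.
Qed.


(* The embedding of C^n into the regular representation, which bounds the
   operator norm of rep a by the C*-norm of a. *)
Let emb x (i0 : 'I_n) : A :=
  galg_of (fun s => x (s i0) 0 / (Num.sqrt (stab i0)%:R : R)%:C).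

Let emb_rep a x i0 : emb (rep a *m x) i0 = a * emb x i0.
Proof.
apply: galgP => s; rewrite gcoefM gcoefE rep_entry mulr_suml.
by apply: eq_bigr => t _; rewrite gcoefE permM mulrA.
Qed.

Let emb_norm x i0 : l2norm (emb x i0) ^+ 2 = cnorm2 x.
Proof.
rewrite sqr_sqrtr ?sumr_ge0 // => [|s _]; last exact: sqr_ge0.
rewrite (partition_big (fun s : 'S_n => s i0) xpredT) //=.
apply: eq_bigr => i _.
have stab0 : (0 < stab i0)%N by apply/card_gt0P; exists 1%g; rewrite inE perm1.
under eq_bigr => s /eqP si do
  rewrite gcoefE si Normc.normcM Normc.normcV exprMn exprVn /= expr0n addr0
    sqrtr_sqr ger0_norm ?sqrtr_ge0 // sqr_sqrtr ?ler0n //.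
rewrite sumr_const.
suff -> : #|[pred s : 'S_n | s i0 == i]| = stab i0.
  by rewrite -[_ *+ _]mulr_natr divfK // pnatr_eq0 -lt0n.
rewrite /stab -!sum1_card (reindex_inj (mulIg (tperm i i0))) /=.
apply: eq_bigl => s; rewrite !inE permM.
by rewrite -(inj_eq (@perm_inj _ (tperm i i0))) tpermK tpermL.
Qed.

Lemma xi_state_exists : exists f : {scalar A}, is_state f /\
  forall s, f (delta s) = inner (xi R n) (perm_rep R s *m xi R n).
Proof.
exists u; split=> [|s]; last exact: lin_ext_delta.
split => //; apply/eqP; rewrite eq_le; apply/andP; split.
  apply: ge_ereal_sup => _ [a a1 <-]; rewrite lee_fin uE.
  apply: normc_inner; first by rewrite xi_unit.
  have i0 : 'I_n by exact: (Ordinal (ltnW n2)).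
  have l0 b : 0 <= l2norm b by exact: sqrtr_ge0.
  rewrite -(emb_norm _ i0) emb_rep expr_le1 //.
  rewrite -lee_fin; apply: le_trans a1; apply: ereal_sup_ubound.
  exists (emb (xi R n) i0) => //=.
  by rewrite -(@expr_le1 _ 2) // emb_norm xi_unit.
apply: ereal_sup_ubound; exists 1 => /=.
  by apply: ge_ereal_sup => _ [b b1 <-]; rewrite mul1r lee_fin.
rewrite lin_ext_delta.
have -> : perm_rep R (1%g : 'S_n) *m xi R n = xi R n.
  by rewrite (_ : perm_rep R _ = 1%:M) ?mul1mx //; apply/matrixP => i j; rewrite !mxE perm1.
rewrite /inner; under eq_bigr do rewrite normc_sqr.
by rewrite -(rmorph_sum (real_complex R)) -/(cnorm2 _) xi_unit rmorph1 Normc.normc1.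
Qed.

End XiState.

(* Main.v *)
Require Import Defs.
From mathcomp Require Import all_boot all_order all_algebra all_fingroup.
From mathcomp Require Import complex.
From mathcomp Require Import all_classical all_reals all_analysis.
From mathcomp Require Import ring lra.

Import Order.TTheory GRing.Theory Num.Theory.
Local Open Scope ring_scope.

(** For a projection p, comparing coefficients of p = p p^* at the identity gives
    p_e = sum_s |p_s|^2, so sum_(s <> e) |p_s|^2 = p_e - p_e^2 <= 1/4, and by
    Cauchy-Schwarz ||nu - pi||^2 <= 1/4 sum_(s <> e) |nu(delta^s)|^2.  Every
    s <> e satisfies 0 <= u(delta^s) <= 1 - d, where d is the least squared gap
    between two components of xi and d n^(n-2) >= 1 - 3 / sqrt n.  Hence
    u(delta^s)^(2k) <= exp(-2kd) <= n^(-n) exp(-2Ac) for large n, because alpha > 1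
    and A < 1 absorb the error 3 / sqrt n, and it remains to bound the number of
    permutations by n^n. *)

(** * Distance to the Haar state from the values on the basis *)

Lemma sum_mul_sqr_le (F : realFieldType) (I : finType) (P : pred I)
    (x y : I -> F) :
  (\sum_(i | P i) x i * y i) ^+ 2 <=
  (\sum_(i | P i) x i ^+ 2) * (\sum_(i | P i) y i ^+ 2).
Proof.
(* Lagrange's identity: this double sum is twice the difference of the two sides. *)
have : 0 <= \sum_(i | P i) \sum_(j | P j) (x i * y j - x j * y i) ^+ 2.
  by apply: sumr_ge0 => i _; apply: sumr_ge0 => j _; exact: sqr_ge0.
have -> : \sum_(i | P i) \sum_(j | P j) (x i * y j - x j * y i) ^+ 2 =
    \sum_(i | P i) \sum_(j | P j) (x i ^+ 2 * y j ^+ 2) +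
    \sum_(i | P i) \sum_(j | P j) (y i ^+ 2 * x j ^+ 2) -
    2 * \sum_(i | P i) \sum_(j | P j) ((x i * y i) * (x j * y j)).
  rewrite mulr_sumr -sumrN -!big_split /=; apply: eq_bigr => i _.
  rewrite mulr_sumr -sumrN -!big_split /=; apply: eq_bigr => j _.
  by ring.
rewrite -!big_distrlr /=; nra.
Qed.

Lemma normc_sum_le (R : realType) (I : finType) (P : pred I) (F : I -> R[i]%C) :
  Normc.normc (\sum_(i | P i) F i) <= \sum_(i | P i) Normc.normc (F i).
Proof.
elim/big_rec2: _ => [|i p q _ pq]; first by rewrite Normc.normc0.
by rewrite (le_trans (le_normcD _ _)) // lerD2l.
Qed.

Lemma normc_ge0 (R : realType) (z : R[i]%C) : 0 <= Normc.normc z.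
Proof. by case: z => a b; exact: sqrtr_ge0. Qed.

Lemma normc_real (R : realType) (x : R) : Normc.normc x%:C%C = `|x|.
Proof. by rewrite /= expr0n addr0 sqrtr_sqr. Qed.

Lemma mul_conjc_normc (R : realType) (z : R[i]%C) :
  z * z^*%C = (Normc.normc z ^+ 2)%:C%C.
Proof. by rewrite rmorphXn -sqr_normc normc_def; case: z. Qed.

Lemma projection_gcoef1 (R : realType) (n : nat) (p : galg R n) :
  is_projection p ->
  gcoef p 1%g = (\sum_s Normc.normc (gcoef p s) ^+ 2)%:C%C.
Proof.
move=> [ps pp]; rewrite {1}pp gcoefM rmorph_sum; apply: eq_bigr => s _.
by rewrite {2}ps gcoefE mul1g invgK mul_conjc_normc.
Qed.

Lemma linear_delta (R : realType) (n : nat) (f : {scalar (galg R n)}) a :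
  f a = \sum_s gcoef a s * f (delta s).
Proof.
by rewrite {1}(galg_basis a) linear_sum; apply: eq_bigr => s _; rewrite linearZ.
Qed.

Lemma tv_dist_haar_sqr_le (R : realType) (n : nat) (f : {scalar (galg R n)}) :
  f (delta 1%g) = 1 ->
  (tv_dist f haar ^+ 2 <=
   (4^-1 * \sum_(s : 'S_n | s != 1%g) Normc.normc (f (delta s)) ^+ 2)%:E)%E.
Proof.
move=> f1; set B := 4^-1 * _.
have B0 : 0 <= B.
  by rewrite mulr_ge0 ?invr_ge0 // sumr_ge0 // => s _; exact: sqr_ge0.
have tv_le : (tv_dist f haar <= (Num.sqrt B)%:E)%E.
  apply: ge_ereal_sup => _ [p pproj <-]; rewrite lee_fin.
  rewrite -(@ler_pXn2r _ 2) ?nnegrE ?normc_ge0 ?sqrtr_ge0 // sqr_sqrtr //.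
  have -> : f p - haar p = \sum_(s | s != 1%g) gcoef p s * f (delta s).
    rewrite (linear_delta _ _ f) (linear_delta _ _ haar) -sumrB (bigD1 1%g) //=.
    rewrite f1 lin_ext_delta eqxx subrr add0r; apply: eq_bigr => s /negPf s1.
    by rewrite lin_ext_delta s1 mulr0 subr0.
  have q1 := projection_gcoef1 _ _ _ pproj.
  set q := \sum_s _ in q1.
  have q0 : 0 <= q by apply: sumr_ge0 => s _; exact: sqr_ge0.
  have qE : \sum_(s : 'S_n | s != 1%g) Normc.normc (gcoef p s) ^+ 2 = q - q ^+ 2.
    rewrite {1}/q [in RHS](bigD1 1%g) //= q1 normc_real ger0_norm //.
    by rewrite addrAC subrr add0r.
  have := @sum_mul_sqr_le R _ (fun s : 'S_n => s != 1%g)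
    (fun s => Normc.normc (gcoef p s)) (fun s => Normc.normc (f (delta s))).
  rewrite qE => cs; apply: le_trans (le_trans _ cs) _.
    rewrite ler_pXn2r ?nnegrE ?normc_ge0 //; last first.
      by rewrite sumr_ge0 // => s _; rewrite mulr_ge0 ?normc_ge0.
    apply: le_trans (normc_sum_le _ _ _ _) _.
    by apply: ler_sum => s _; rewrite Normc.normcM.
  apply: ler_wpM2r; first by rewrite sumr_ge0 // => s _; exact: sqr_ge0.
  (* [q - q ^+ 2 <= 1/4] is [0 <= (q - 1/2) ^+ 2] expanded. *)
  by have := sqr_ge0 (q - 2^-1); lra.
(* Squaring [tv_le] in the extended reals needs a nonnegative left side; the projection 0 provides
   it. *)
have tv_ge0 : (0 <= tv_dist f haar)%E.
  apply: ereal_sup_ubound; exists 0 => /=; last by rewrite !linear0 addr0 Normc.normc0.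
  split; last by rewrite mulr0.
  have g0 t : gcoef (0 : galg R n) t = 0 by rewrite /gcoef ffunE.
  by apply: galgP => s; rewrite g0 gcoefE g0 conjc0.
rewrite -(sqr_sqrtr B0) !expr2 EFinM.
exact: lee_pmul.
Qed.

(** The comultiplication sends [delta s] to its tensor square, so convolution multiplies values on
    the basis pointwise. *)
Lemma conv_pow_delta (R : realType) (n : nat) (f : {scalar (galg R n)}) k s :
  (0 < k)%N -> conv_pow f k (delta s) = f (delta s) ^+ k.
Proof.
case: k => // k _; rewrite /conv_pow /=; elim: k => [|k IH] //=.
rewrite conv_funE (bigD1 s) //= big1 => [|t /negPf ts].
  by rewrite gcoef_delta eqxx mul1r addr0 IH -exprS.
by rewrite gcoef_delta ts mul0r.
Qed.

(** * Components of [xi] and the gap between them *)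

Section XiWeights.
Context (R : realType) (n : nat).

Let w0 : R := (n%:R - 1) / (n%:R ^+ n - 1).

Definition xi_weight (i : 'I_n) : R := Num.sqrt (n%:R ^+ (n - i.+1) * w0).

(** Makes the values of the state visibly real and nonnegative, so that their powers can be
    estimated in [R]. *)
Lemma inner_xi_perm_rep (s : 'S_n) :
  inner (xi R n) (perm_rep R s *m xi R n) =
  (\sum_i xi_weight i * xi_weight (s i))%:C%C.
Proof.
have xiE i : xi R n i 0 = (xi_weight i)%:C%C by rewrite mxE.
rewrite /inner (reindex_inj (@perm_inj _ s)) rmorph_sum /=.
apply: eq_bigr => i _; rewrite xiE -[Num.conj _]/(conjc _) conjc_real.
rewrite mxE (bigD1 i) //= big1 ?addr0 => [|j /negPf ji].
  by rewrite xiE mxE eqxx mul1r [RHS]rmorphM mulrC.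
by rewrite mxE (inj_eq (@perm_inj _ s)) eq_sym ji mul0r.
Qed.

Context (n2 : (2 <= n)%N).

Let n1 : (1 : R) < n%:R. Proof. by rewrite ltr1n. Qed.

Let nn : (0 : R) < n%:R ^+ n - 1.
Proof. by rewrite subr_gt0 exprn_egt1 // -lt0n (ltn_trans _ n2). Qed.

Let w0_ge0 : 0 <= w0.
Proof. by apply: divr_ge0; [rewrite subr_ge0|]; exact: ltW. Qed.

Let w_ge0 m : 0 <= n%:R ^+ m * w0.
Proof. by apply: mulr_ge0; rewrite ?exprn_ge0. Qed.

Lemma xi_weight_ge0 i : 0 <= xi_weight i.
Proof. exact: sqrtr_ge0. Qed.

Lemma sum_sqr_xi_weight : \sum_i xi_weight i ^+ 2 = 1.
Proof.
under eq_bigr => i _ do rewrite sqr_sqrtr ?w_ge0 //.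
rewrite -mulr_suml (reindex_inj rev_ord_inj) mulrA /=.
under eq_bigr => i _ do rewrite subnSK ?ltn_ord // subKn 1?ltnW //.
by rewrite [_ * (_ - 1)]mulrC -subrX1 divff ?gt_eqF.
Qed.

(** The squared difference of the two smallest components, [sqrt (n * w0)] and [sqrt w0]. *)
Definition xi_gap : R := (Num.sqrt n%:R - 1) ^+ 2 * w0.

(** Components shrink by a factor of at least [sqrt n] from [i] to a later [j], so their difference
    is at least [sqrt n - 1] times the smaller one, which is itself at least [sqrt w0]. *)
Lemma xi_gap_le i j : i != j -> xi_gap <= (xi_weight i - xi_weight j) ^+ 2.
Proof.
wlog ij : i j / (i < j)%N => [H|_].
  rewrite neq_ltn => /orP[] ij; first by apply: H; rewrite // neq_ltn ij.
  by rewrite -[_ - _]opprB sqrrN; apply: H; rewrite // neq_ltn ij.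
have wj : Num.sqrt w0 <= xi_weight j.
  by rewrite ler_sqrt ?w_ge0 // ler_peMl // exprn_ege1 // ltW.
have wi : Num.sqrt n%:R * xi_weight j <= xi_weight i.
  rewrite -sqrtrM // ler_sqrt ?w_ge0 // mulrA ler_wpM2r //.
  rewrite -exprS ler_weXn2l //; first exact: ltW.
  by rewrite ltn_sub2l // (leq_ltn_trans ij).
have sn : 1 <= Num.sqrt n%:R :> R by rewrite -[leLHS]sqrtr1 ler_sqrt ?ltW // (lt_trans _ n1).
rewrite /xi_gap -{1}(sqr_sqrtr w0_ge0) -exprMn ler_pXn2r ?nnegrE.
- apply: le_trans (_ : (Num.sqrt n%:R - 1) * xi_weight j <= _).
    by rewrite ler_wpM2l ?subr_ge0.
  by rewrite mulrBl mul1r lerD2r.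
- by [].
- by rewrite mulr_ge0 ?subr_ge0 ?sqrtr_ge0.
- by rewrite subr_ge0 (le_trans _ wi) // ler_peMl ?xi_weight_ge0.
Qed.

(* Any s <> 1 moves both some i and s i, so two terms of
   1 - u(s) = 1/2 sum_i (alpha_i - alpha_(s i))^2 are at least the gap. *)
Lemma xi_corr_le (s : 'S_n) : s != 1%g ->
  \sum_i xi_weight i * xi_weight (s i) <= 1 - xi_gap.
Proof.
move=> s1; have [i si] : exists i, s i != i.
  apply/existsP; rewrite -negb_forall; apply: contra s1 => /forallP H.
  by apply/eqP/permP => i; rewrite perm1; apply/eqP.
have ssi : s (s i) != s i by rewrite (inj_eq (@perm_inj _ s)).
have : 2 * xi_gap <= \sum_i (xi_weight i - xi_weight (s i)) ^+ 2.
  rewrite (bigD1 i) //= (bigD1 (s i)) //= addrA mulr_natl mulr2n.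
  rewrite -[leLHS]addr0; apply: lerD; last first.
    by apply: sumr_ge0 => j _; exact: sqr_ge0.
  by apply: lerD; apply: xi_gap_le; rewrite eq_sym.
under eq_bigr => j _ do rewrite sqrrB.
rewrite big_split sumrB /= sum_sqr_xi_weight.
have -> : \sum_j xi_weight (s j) ^+ 2 = 1.
  rewrite -sum_sqr_xi_weight [RHS](reindex_inj (@perm_inj _ s)) //.
by rewrite sumrMnl -mulr_natl; lra.
Qed.

(** With [t = 1 / sqrt n], replacing [n ^ n - 1] by [n ^ n] in [w0] turns the right side into
    [(1 - t)^3 (1 + t)], and [(1 - t)^3 >= 1 - 3 t]. *)
Lemma xi_gap_ge :
  1 - 3 * (Num.sqrt n%:R)^-1 <= xi_gap * n%:R ^+ (n - 2) :> R.
Proof.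
set r : R := Num.sqrt n%:R.
have rr : r ^+ 2 = n%:R by rewrite sqr_sqrtr.
have r1 : 1 <= r by rewrite -[leLHS]sqrtr1 ler_sqrt ?ltW // (lt_trans _ n1).
have r0 : 0 < r by rewrite (lt_le_trans _ r1).
have t0 : 0 <= 1 - r^-1 by rewrite subr_ge0 invf_le1.
apply: le_trans (_ : (1 - r^-1) ^+ 3 <= _).
  have : 0 <= r^-1 by rewrite invr_ge0 ltW.
  by move: t0; set t := r^-1; nra.
have w0_ge : (n%:R - 1) / n%:R ^+ n <= w0.
  rewrite /w0 ler_wpM2l ?subr_ge0 ?(ltW n1) // lef_pV2 ?posrE ?exprn_gt0 //.
    by rewrite gerBl.
  by rewrite (lt_trans _ n1).
apply: le_trans
  (_ : (r - 1) ^+ 2 * ((n%:R - 1) / n%:R ^+ n) * n%:R ^+ (n - 2) <= _).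
  have nE : n%:R ^+ n = n%:R ^+ (n - 2) * n%:R ^+ 2 :> R by rewrite -exprD subnK.
  rewrite nE -rr.
  have rX : r ^+ 2 ^+ (n - 2) != 0 by rewrite !expf_neq0 // gt_eqF.
  have -> : (r - 1) ^+ 2 * ((r ^+ 2 - 1) / (r ^+ 2 ^+ (n - 2) * r ^+ 2 ^+ 2))
     * r ^+ 2 ^+ (n - 2) = (1 - r^-1) ^+ 3 * (1 + r^-1).
    by field; rewrite rX gt_eqF.
  by rewrite ler_peMr ?exprn_ge0 // lerDl invr_ge0 ltW.
by rewrite ler_wpM2r ?exprn_ge0 // ler_wpM2l ?sqr_ge0.
Qed.

End XiWeights.

(** * Counting permutations and assembling the bound *)

Lemma fact_le_expn n : (n`! <= n ^ n)%N.
Proof.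
(* Permutations inject into the self-maps of ['I_n]. *)
have := leq_card _ (@val_inj _ _ {perm 'I_n}).
by rewrite card_Sn card_ffun card_ord.
Qed.

Theorem mainTheorem2 (R : realType) (alpha A : R) :
  1 < alpha -> A < 1 ->
  exists N : nat, forall (n : nat) (u : {scalar (galg R n)}) (c : R) (k : nat),
    (2 <= n)%N -> (N <= n)%N ->
    is_state u ->
    (forall s : 'S_n, u (delta s) = inner (xi R n) (perm_rep R s *m xi R n)) ->
    0 <= c -> (0 < k)%N ->
    k%:R = alpha * n%:R ^+ (n - 1) * ln n%:R / 2 + c * n%:R ^+ (n - 2) ->
    (tv_dist (conv_pow u k) haar ^+ 2 <= (2^-1 * expR (- (2 * A * c)))%:E)%E.
Proof.
move=> alpha1 A1.
have alpha0 : 0 < alpha by rewrite (lt_trans _ alpha1).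
(* The tolerated relative error of the gap: it must keep [1 - e] above both [A] and [1 / alpha]. *)
pose e := Num.min (1 - A) (1 - alpha^-1).
have e0 : 0 < e by rewrite lt_min !subr_gt0 A1 invf_lt1.
have eA : A <= 1 - e by rewrite lerBrDl -lerBrDr ge_min lexx.
have ealpha : 1 <= alpha * (1 - e).
  rewrite -ler_pdivrMl // mulr1 lerBrDl -lerBrDr ge_min lexx orbT //.
(* From [n >= (3 / e)^2] on, the error [3 / sqrt n] is at most [e]. *)
exists (Num.bound ((3 / e) ^+ 2)) => n u c k n2 Nn _ uE c0 k0 kE.
have nr0 : 0 < n%:R :> R by rewrite ltr0n (ltn_trans _ n2).
have small : 3 * (Num.sqrt n%:R)^-1 <= e :> R.
  rewrite ler_pdivrMr ?sqrtr_gt0 // mulrC -ler_pdivrMr //.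
  rewrite -[leLHS]ger0_norm ?divr_ge0 ?(ltW e0) // -sqrtr_sqr ler_sqrt ?ltW //.
  apply: lt_le_trans (archi_boundP _) _; first exact: sqr_ge0.
  by rewrite ler_nat.
have ln0 : 0 <= ln n%:R :> R by rewrite ln_ge0 // ler1n (ltn_trans _ n2).
pose w (s : 'S_n) := \sum_i xi_weight R n i * xi_weight R n (s i).
have w_ge0 s : 0 <= w s.
  by apply: sumr_ge0 => i _; rewrite mulr_ge0 ?xi_weight_ge0.
have fE s : conv_pow u k (delta s) = (w s ^+ k)%:C%C.
  by rewrite conv_pow_delta // uE inner_xi_perm_rep rmorphXn.
apply: le_trans (tv_dist_haar_sqr_le _ _ _ _) _.
  rewrite fE; have -> : w 1%g = 1; last by rewrite expr1n.
  rewrite -(sum_sqr_xi_weight R n n2); apply: eq_bigr => i _.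
  by rewrite perm1 expr2.
rewrite lee_fin.
(* With [g] the gap and [m = n ^ (n - 2)], the right side is [alpha (g m) n ln n + 2 (g m) c]. Since
   [g m >= 1 - e], the factor [alpha] absorbs the loss in the first term and [A] the loss in the
   second. *)
have kgap : n%:R * ln n%:R + 2 * A * c <= (2 * k)%:R * xi_gap R n.
  have n1E : n%:R ^+ (n - 1) = n%:R * n%:R ^+ (n - 2) :> R.
    by rewrite -exprS -subSn.
  rewrite natrM kE n1E.
  have := xi_gap_ge R n n2; set g := xi_gap R n; set m := n%:R ^+ (n - 2) => gm.
  have {}gm : 1 - e <= g * m by apply: le_trans gm; rewrite lerB.
  have -> : 2 * (alpha * (n%:R * m) * ln n%:R / 2 + c * m) * g =
     (alpha * (g * m)) * (n%:R * ln n%:R) + 2 * ((g * m) * c) by field.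
  apply: lerD.
    rewrite ler_peMl ?mulr_ge0 ?ler0n //; apply: le_trans ealpha _.
    by rewrite ler_wpM2l // ltW.
  rewrite -mulrA ler_wpM2l // ler_wpM2r //; exact: le_trans gm.
have term s : s != 1%g -> Normc.normc (conv_pow u k (delta s)) ^+ 2 <=
    (n%:R ^+ n)^-1 * expR (- (2 * A * c)).
  move=> s1; rewrite fE normc_real ger0_norm ?exprn_ge0 // -exprM mulnC.
  (* Uses [w s <= 1 - g <= exp (- g)] for the gap [g]. *)
  apply: le_trans (_ : expR (- xi_gap R n) ^+ (2 * k) <= _).
    rewrite ler_pXn2r ?nnegrE ?muln_gt0 ?k0 ?expR_ge0 //.
    exact: le_trans (xi_corr_le R n n2 s s1) (expR_ge1Dx _).
  rewrite -expRM_natl mulrN.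
  have -> : (n%:R ^+ n)^-1 = expR (- (n%:R * ln n%:R)) :> R.
    by rewrite expRN expRM_natl lnK ?posrE.
  by rewrite -expRD ler_expR -opprD lerN2.
(* The argument gives the constant 1/4: fewer than [n ^ n] terms, each at most [n ^ (- n)] times the
   exponential. *)
apply: le_trans (_ : 4^-1 * expR (- (2 * A * c)) <= _); last first.
  by rewrite ler_wpM2r ?expR_ge0 //; lra.
rewrite ler_wpM2l ?invr_ge0 //; apply: le_trans (ler_sum _ term) _.
rewrite sumr_const -[leLHS]mulr_natl mulrA ler_piMl ?expR_ge0 //.
rewrite ler_pdivrMr ?exprn_gt0 // mul1r -natrX ler_nat.
apply: leq_trans (max_card _) _; rewrite card_Sn; exact: fact_le_expn.
Qed.
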